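(* For every $\Delta \in \{3,4,5,6,7,8,9\}$ there exist a complex number $\lambda \in U_\Delta$ and a graph $G \in \mathcal{G}_\Delta$ such that $Z_G(\lambda) = 0$.
   Context: For a finite simple graph $G=(V,E)$, a subset $I \subseteq V$ is independent if no two vertices of $I$ are connected by an edge of $G$. The independence polynomial of $G$ is $Z_G(\lambda) = \sum_{I \subseteq V \text{ independent}} \lambda^{|I|}$. For an integer $\Delta \geq 3$, $\mathcal{G}_\Delta$ denotes the set of finite simple graphs of maximum degree at most $\Delta$, and $$U_\Delta = \left\{\frac{-\alpha \cdot (\Delta-1)^{\Delta-1}}{(\Delta-1+\alpha)^{\Delta}} : \alpha \in \mathbb{C},\ |\alpha| < 1\right\} \subseteq \mathbb{C}.$$ *)

(* Defs.v *)
From mathcomp Require Import all_boot all_order all_algebra.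
From mathcomp Require Import classical_sets reals complex.

Set Implicit Arguments.
Unset Strict Implicit.
Unset Printing Implicit Defensive.

Import Order.TTheory GRing.Theory Num.Theory.

Local Open Scope ring_scope.

Record sgraph := SGraph {
  vertex :> finType;
  adj : rel vertex;
  adj_sym : symmetric adj;
  adj_irrefl : irreflexive adj
}.

Definition degree (G : sgraph) (v : G) : nat := #|adj v|.

Definition max_degree (G : sgraph) : nat := (\max_(v : G) degree v)%N.

Definition max_degree_at_most (Delta : nat) (G : sgraph) : Prop :=
  (max_degree G <= Delta)%N.

Definition independent (G : sgraph) (I : {set G}) : bool :=
  [forall u in I, forall v in I, ~~ adj u v].

Definition indep_poly (K : nzRingType) (G : sgraph) : {poly K} :=
  \sum_(I : {set G} | independent I) 'X^#|I|.

(* The order on [R[i]] is partial: [`|alpha| < 1] compares the modulus, which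
   is a real element of [R[i]], with 1. For [3 <= Delta] the denominator never
   vanishes on the open unit disk. *)
Definition U (R : realType) (Delta : nat) : set R[i] :=
  [set - alpha * (Delta%:R - 1) ^+ Delta.-1
         / (Delta%:R - 1 + alpha) ^+ Delta
     | alpha in [set a : R[i] | `|a| < 1]]%classic.

(* Main.v *)
(* For a tree in which all vertices of the same level have the same number of
   children, the independence polynomials of the subtrees satisfy a two-term
   recursion along the levels. After the substitution
     lambda = - alpha (Delta - 1)^(Delta - 1) / (Delta - 1 + alpha)^Delta
   and clearing denominators, Z(lambda) becomes a polynomial P in alpha, and it
   suffices to find a root of P in the open unit disc. For each Delta the
   branching numbers of a suitable tree, and an approximate root of P just
   inside the disc, were found by a computer search. An actual root lies nearby
   because |P| more than doubles over a step that is short relative to the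
   inverse of the degree of P, a comparison certified by ball arithmetic in Z
   along the recursion. *)
Require Import Defs.
From mathcomp Require Import all_boot all_order all_algebra.
From mathcomp Require Import classical_sets reals complex.
From Stdlib Require Import ZArith.
(* ssrnat restores the key [%N] taken by ZArith, and fintype and finset restore
   the names shadowed by classical_sets. *)
From mathcomp Require Import ssrnat fintype finset ssrZ zify ring.

Import Order.TTheory GRing.Theory Num.Theory.

Local Open Scope ring_scope.

Lemma disjoints0 (T : finType) (A : {set T}) : [disjoint A & set0].
Proof. by rewrite disjoints_subset setC0 subsetT. Qed.

(** * Cones over copies of a graph *)

(** The apex [inl tt] is joined to [S] in each of [m] disjoint copies of [G]. When [S] consists of
    the root of [G], this hangs [m] copies of a rooted tree below a new root. *)
Definition cone_adj (G : sgraph) (S : {set G}) (m : nat) :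
    rel (unit + 'I_m * G) :=
  fun x y => match x, y with
  | inl _, inl _ => false
  | inl _, inr q => q.2 \in S
  | inr p, inl _ => p.2 \in S
  | inr p, inr q => (p.1 == q.1) && adj p.2 q.2
  end.

Lemma cone_adj_sym (G : sgraph) (S : {set G}) (m : nat) :
  symmetric (@cone_adj G S m).
Proof. by move=> [[]|p] [[]|q] //=; rewrite adj_sym eq_sym. Qed.

Lemma cone_adj_irrefl (G : sgraph) (S : {set G}) (m : nat) :
  irreflexive (@cone_adj G S m).
Proof. by move=> [[]|p] //=; rewrite adj_irrefl andbF. Qed.

Definition cone (G : sgraph) (S : {set G}) (m : nat) : sgraph :=
  @SGraph _ (@cone_adj G S m) (@cone_adj_sym G S m) (@cone_adj_irrefl G S m).

Definition apex (G : sgraph) (S : {set G}) (m : nat) : {set cone G S m} :=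
  [set inl tt].

Definition void_graph : sgraph :=
  @SGraph void (fun _ _ => false) (fun _ _ => erefl) (fun _ => erefl).

(** The values for [S] empty and for [S] the root are the two quantities that the recursion along
    the levels propagates. *)
Definition avoid (R : nzRingType) (G : sgraph) (S : {set G}) (x : R) : R :=
  \sum_(I : {set G} | independent I && [disjoint I & S]) x ^+ #|I|.

Lemma indep_polyE (R : nzRingType) (G : sgraph) (x : R) :
  (indep_poly R G).[x] = avoid R G set0 x.
Proof.
rewrite /indep_poly horner_sum /avoid; apply: eq_big => [I|I _].
  by rewrite disjoints0 andbT.
by rewrite hornerXn.
Qed.

Lemma avoid_void (R : nzRingType) (S : {set void_graph}) (x : R) :
  avoid R void_graph S x = 1.
Proof.
have E (I : {set void_graph}) : I = set0 by apply/setP => -[].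
rewrite /avoid (eq_bigl (pred1 set0)) => [|I]; last first.
  rewrite (E I) (E S) disjoints0 andbT /= eqxx.
  by apply/forall_inP => -[].
by rewrite big_pred1_eq cards0.
Qed.

Section Cone.
Variables (G : sgraph) (S : {set G}) (m : nat).

(** A vertex set of the cone amounts to a bit for the apex and one trace per copy; reindexing by
    [glue] lets sums over such sets factor over the copies. *)
Definition glue (bf : bool * {ffun 'I_m -> {set G}}) : {set cone G S m} :=
  [set x | match x with inl _ => bf.1 | inr p => p.2 \in bf.2 p.1 end].

Lemma glue_bij : bijective glue.
Proof.
exists (fun I : {set cone G S m} =>
  (inl tt \in I, [ffun i : 'I_m => [set v : G | inr (i, v) \in I]])).
  move=> [b f]; rewrite inE /=; congr pair.
  by apply/ffunP => i; rewrite ffunE; apply/setP => v; rewrite !inE.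
by move=> I; apply/setP => -[[]|[i v]]; rewrite inE //= ffunE inE.
Qed.

Lemma card_glue b f : #|glue (b, f)| = (b + \sum_i #|f i|)%N.
Proof.
rewrite -sum1_card big_mkcond big_sumType /=.
rewrite (big_pred1 tt) => [|[]//]; rewrite inE /=; congr addn.
rewrite (eq_bigr (fun p => if p.2 \in f p.1 then 1 else 0)%N) => [|p _].
  rewrite -(pair_bigA _ (fun i v => if v \in f i then 1 else 0)%N) /=.
  by apply: eq_bigr => i _; rewrite -big_mkcond sum1_card.
by rewrite inE.
Qed.

(** Distinct copies are not adjacent, so besides independence of the traces the only constraint
    comes from the apex, whose presence excludes [S] in every copy. *)
Lemma independent_glue b f :
  independent (glue (b, f)) =
    [forall i, independent (f i)] &&
    (b ==> [forall i, [disjoint f i & S]]).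
Proof.
apply/forall_inP/andP => [H|[/forallP indf disj]].
  split; [apply/forallP => i | apply/implyP => b1; apply/forallP => i].
    apply/forall_inP => u uf; apply/forall_inP => v vf.
    have /forall_inP/(_ (inr (i, v))) := H (inr (i, u)) ltac:(by rewrite inE).
    by rewrite inE /= eqxx; apply.
  rewrite disjoint_subset; apply/subsetP => v vf.
  have /forall_inP/(_ (inr (i, v))) := H (inl tt) ltac:(by rewrite inE).
  by rewrite inE /=; apply.
move=> [[]|[i u]]; rewrite inE /= => hu; apply/forall_inP => -[[]|[j v]];
  rewrite inE //= => hv.
- have /forallP/(_ j) := implyP disj hu.
  by rewrite disjoint_subset => /subsetP/(_ v hv).
- have /forallP/(_ i) := implyP disj hv.
  by rewrite disjoint_subset => /subsetP/(_ u hu).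
case: eqP => //= ij; rewrite -ij in hv.
by have /forall_inP/(_ u hu)/forall_inP/(_ v hv) := indf i.
Qed.

Lemma disjoint_glue_apex b f : [disjoint glue (b, f) & apex G S m] = ~~ b.
Proof. by rewrite disjoint_sym disjoints1 inE. Qed.

(** Distributivity: expanding the power picks one set per copy. *)
Lemma avoid_exp (R : comNzRingType) (T : {set G}) (x : R) :
  avoid R G T x ^+ m =
  \sum_(f : {ffun 'I_m -> {set G}}
    | [forall i, independent (f i)] && [forall i, [disjoint f i & T]])
    x ^+ (\sum_i #|f i|).
Proof.
rewrite -[in LHS](card_ord m) -prodr_const /avoid bigA_distr_big.
apply: eq_big => [f|f _]; last by rewrite expr_sum.
apply/familyP/andP => [H|[/forallP H1 /forallP H2] i].
  by split; apply/forallP => i; have /andP[] := H i.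
by rewrite unfold_in; apply/andP; split.
Qed.

Lemma avoid_glue (R : comNzRingType) (T : {set cone G S m}) (x : R) :
  avoid R (cone G S m) T x = \sum_b
    \sum_(f : {ffun 'I_m -> {set G}}
      | independent (glue (b, f)) && [disjoint glue (b, f) & T])
    x ^+ (b + \sum_i #|f i|).
Proof.
rewrite [LHS](reindex glue) /=; last exact: onW_bij glue_bij.
rewrite (pair_big_dep xpredT (fun b (f : {ffun 'I_m -> {set G}}) =>
    independent (glue (b, f)) && [disjoint glue (b, f) & T])
   (fun (b : bool) f => x ^+ (b + \sum_i #|f i|))) /=.
by apply: eq_big => [[b f]|[b f] _] //; rewrite card_glue.
Qed.

(** Without the apex the copies are unconstrained; with it there is a factor [x] and each trace must
    avoid [S]. *)
Lemma avoid_cone (R : comNzRingType) (x : R) :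
  avoid R (cone G S m) set0 x = avoid R G set0 x ^+ m + x * avoid R G S x ^+ m.
Proof.
rewrite avoid_glue big_bool /= addrC !avoid_exp mulr_sumr; congr (_ + _).
  apply: eq_bigl => f; rewrite disjoints0 andbT independent_glue.
  by congr andb; apply/esym/forallP => i; rewrite disjoints0.
apply: eq_big => f; first by rewrite disjoints0 andbT independent_glue.
by rewrite add1n exprS.
Qed.

Lemma avoid_apex (R : comNzRingType) (x : R) :
  avoid R (cone G S m) (apex G S m) x = avoid R G set0 x ^+ m.
Proof.
rewrite avoid_glue big_bool /= [X in X + _]big_pred0 ?add0r => [|f]; last first.
  by rewrite disjoint_glue_apex andbF.
rewrite avoid_exp; apply: eq_bigl => f.
rewrite disjoint_glue_apex andbT independent_glue; congr andb.
by apply/esym/forallP => i; rewrite disjoints0.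
Qed.

Lemma degree_cone_apex : @degree (cone G S m) (inl tt) = (m * #|S|)%N.
Proof.
rewrite /degree -sum1_card big_mkcond big_sumType /=.
rewrite (big_pred1 tt) => [|[]//]; rewrite add0n.
rewrite (eq_bigr (fun p => if p.2 \in S then 1 else 0)%N) => [|p _ //].
rewrite -(pair_bigA _ (fun (i : 'I_m) v => if v \in S then 1 else 0)%N) /=.
by rewrite -big_mkcond sum1_card sum_nat_const card_ord.
Qed.

Lemma degree_cone_inr i v :
  @degree (cone G S m) (inr (i, v)) = ((v \in S) + degree v)%N.
Proof.
rewrite /degree -sum1_card big_mkcond big_sumType /=.
rewrite (big_pred1 tt) => [|[]//]; congr addn.
rewrite (eq_bigr (fun p => if (p.1 == i) && adj v p.2 then 1 else 0)%N) => [|p _].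
  rewrite -(pair_bigA _ (fun j u => if (j == i) && adj v u then 1 else 0)%N) /=.
  rewrite (bigD1 i) //= [X in (_ + X)%N]big1 ?addn0 => [|j /negPf ->];
    last by rewrite big1.
  by rewrite eqxx /= -big_mkcond sum1_card.
by rewrite eq_sym.
Qed.

End Cone.

(** * Locating a root of a polynomial *)

(** By induction $(1+t)^k(1-kt) \le 1$, since $(1+t)(1-(k+1)t) \le 1-kt$; the hypothesis makes $1-nt
    \ge 1/2$. *)
Lemma expr1D_le2 (R : numDomainType) (t : R) (n : nat) :
  0 <= t -> 2 * n%:R * t <= 1 -> (1 + t) ^+ n <= 2.
Proof.
move=> t0 nt.
have H k : (1 + t) ^+ k * (1 - k%:R * t) <= 1.
  elim: k => [|k IH]; first by rewrite mul0r subr0 mulr1.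
  apply: le_trans IH; rewrite exprSr -mulrA ler_wpM2l ?exprn_ge0 ?addr_ge0 //.
  rewrite mulrDl mul1r -natr1 mulrDl mul1r mulrBr mulr1 -subr_ge0.
  have -> : 1 - k%:R * t - (1 - (k%:R * t + t) + (t - t * (k%:R * t + t)))
    = t * (k%:R * t + t) by ring.
  by rewrite mulr_ge0 ?addr_ge0 ?mulr_ge0.
have h1 := H n.
have : (1 + t) ^+ n <= (1 + t) ^+ n * (1 - n%:R * t) * 2.
  rewrite -mulrA ler_peMr ?exprn_ge0 ?addr_ge0 //.
  rewrite mulrBl mul1r mulrC mulrA lerBrDr -[2 in leRHS]/(1 + 1 : R) lerD2l.
  exact: nt.
by move=> /le_trans; apply; rewrite -[leRHS]mul1r ler_wpM2r.
Qed.

(* If every root is at distance at least [r] from [x], moving from [x] to [y]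
   changes each factor of [p], hence [p] itself, by little. *)
Lemma root_near (K : numClosedFieldType) (p : {poly K}) (n : nat) (x y r : K) :
  (size p <= n.+1)%N -> 0 < r -> 2 * n%:R * `|y - x| <= r ->
  2 * `|p.[x]| < `|p.[y]| -> exists2 z, root p z & `|z - x| < r.
Proof.
move=> szp r0 nyx pxy; have [s ps] := closed_field_poly_normal p.
have p0 : p != 0.
  by apply: contraTneq pxy => ->; rewrite !horner0 normr0 mulr0 ltxx.
have lc0 : lead_coef p != 0 by rewrite lead_coef_eq0.
have szs : (size s <= n)%N.
  by move: szp; rewrite ps size_scale // size_prod_XsubC.
have [/hasP[z zs zx]|/hasPn far] := boolP (has (fun z => `|z - x| < r) s).
  exists z => //; rewrite ps rootZ //.
  by rewrite root_prod_XsubC.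
suff : `|p.[y]| <= 2 * `|p.[x]| by move=> /(lt_le_trans pxy); rewrite ltxx.
(* For a root $z$, $|y-z| \le |x-z| + tr \le (1+t)|x-z|$. There are at most [n] factors, so the
   product grows at most by $(1+t)^n \le 2$. *)
set t := `|y - x| / r.
have t0 : 0 <= t by rewrite divr_ge0 // ltW.
have t2 : (1 + t) ^+ size s <= 2.
  apply: expr1D_le2 => //; rewrite /t mulrA ler_pdivrMr // mul1r.
  apply: le_trans nyx; rewrite ler_wpM2r // ler_wpM2l //.
  by rewrite ler_nat.
rewrite ps !hornerZ !normrM mulrCA ler_wpM2l //.
apply: le_trans (_ : (1 + t) ^+ size s * `|(\prod_(z <- s) ('X - z%:P)).[x]| <= _);
  last by rewrite ler_wpM2r.
have {far} : forall z, z \in s -> r <= `|z - x|.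
  (* The order of [K] is partial; negating [<] requires both sides to be real. *)
  by move=> z /far; rewrite real_ltNge ?negbK // ?gtr0_real // ?normr_real.
elim: s {ps szs t2} => [|z s IH] far; first by rewrite !big_nil !hornerC normr1 mul1r.
rewrite !big_cons !hornerM !normrM exprS mulrACA.
apply: ler_pM => //; last by apply: IH => w ws; apply: far; rewrite inE ws orbT.
rewrite !hornerXsubC mulrDl mul1r -[y - z](subrKA x) addrC.
apply: le_trans (ler_normD _ _) _; rewrite lerD2l.
have rz : r <= `|x - z| by rewrite distrC far ?inE ?eqxx.
by rewrite /t mulrAC ler_pdivlMr // ler_wpM2l.
Qed.

(** * Ball arithmetic *)

(* In the unit [u], [Ball x y r] stands for the disc of center [(x + 'i y) u]
   and radius [r u]; see [in_ball]. *)
Record ball := Ball { ball_re : Z; ball_im : Z; ball_rad : Z }.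

Definition ball_add (X Y : ball) : ball :=
  Ball (ball_re X + ball_re Y)%Z (ball_im X + ball_im Y)%Z
       (ball_rad X + ball_rad Y)%Z.

(** An upper bound for the modulus of the center that stays within the integers. *)
Definition ball_size (X : ball) : Z := (Z.abs (ball_re X) + Z.abs (ball_im X))%Z.

(** For centers $a$, $b$ the radius bounds $zw - ab = z(w-b) + (z-a)b$. *)
Definition ball_mul (X Y : ball) : ball :=
  Ball (ball_re X * ball_re Y - ball_im X * ball_im Y)%Z
       (ball_re X * ball_im Y + ball_im X * ball_re Y)%Z
       ((ball_size X + ball_rad X) * ball_rad Y + ball_rad X * ball_size Y)%Z.

(* Each of the three floors loses less than 1. *)
Definition ball_shift (k : nat) (X : ball) : ball :=
  let q := Z.of_nat k in
  Ball (Z.shiftr (ball_re X) q) (Z.shiftr (ball_im X) q)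
       (Z.shiftr (ball_rad X) q + 3)%Z.

Section Ball.
Variable K : numClosedFieldType.

Definition ZtoC (z : Z) : K := (int_of_Z z)%:~R.

Lemma ZtoCD : {morph ZtoC : x y / (x + y)%Z >-> x + y}.
Proof. by move=> x y; rewrite /ZtoC (rmorphD int_of_Z) intrD. Qed.

Lemma ZtoCB : {morph ZtoC : x y / (x - y)%Z >-> x - y}.
Proof. by move=> x y; rewrite /ZtoC (rmorphB int_of_Z) intrB. Qed.

Lemma ZtoCM : {morph ZtoC : x y / (x * y)%Z >-> x * y}.
Proof. by move=> x y; rewrite /ZtoC (rmorphM int_of_Z) intrM. Qed.

Lemma ZtoCN : {morph ZtoC : x / (- x)%Z >-> - x}.
Proof. by move=> x; rewrite /ZtoC (rmorphN int_of_Z) mulrNz. Qed.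

Lemma ZtoC_nat (n : nat) : ZtoC (Z.of_nat n) = n%:R.
Proof. by rewrite /ZtoC (_ : int_of_Z _ = n :> int) //; lia. Qed.

Lemma ler_ZtoC (x y : Z) : (x <= y)%Z -> ZtoC x <= ZtoC y.
Proof. by move=> xy; rewrite ler_int; lia. Qed.

Lemma ltr_ZtoC (x y : Z) : (x < y)%Z -> ZtoC x < ZtoC y.
Proof. by move=> xy; rewrite ltr_int; lia. Qed.

Lemma ZtoC_real (x : Z) : ZtoC x \is Num.real.
Proof. exact: realz. Qed.

Lemma normr_ZtoC (x : Z) : `|ZtoC x| = ZtoC (Z.abs x).
Proof. by rewrite /ZtoC -intr_norm; congr (_%:~R); lia. Qed.

Lemma ZtoC_pow2 (k : nat) : ZtoC (2 ^ Z.of_nat k) = 2 ^+ k.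
Proof.
elim: k => [|k IH]; first exact: (ZtoC_nat 1).
rewrite (_ : Z.of_nat k.+1 = Z.succ (Z.of_nat k)); last by lia.
by rewrite Z.pow_succ_r ?ZtoCM ?IH ?exprS ?(ZtoC_nat 2) //; lia.
Qed.

Definition center (X : ball) : K := ZtoC (ball_re X) + 'i * ZtoC (ball_im X).

Definition in_ball (u z : K) (X : ball) : Prop :=
  `|z - center X * u| <= ZtoC (ball_rad X) * u.

Lemma normr_center (X : ball) : `|center X| <= ZtoC (ball_size X).
Proof.
rewrite /ball_size ZtoCD -!normr_ZtoC; apply: le_trans (ler_normD _ _) _.
by rewrite normrM normCi mul1r.
Qed.

Lemma normr_center_re (X : ball) : ZtoC (Z.abs (ball_re X)) <= `|center X|.
Proof.
rewrite -normr_ZtoC -(@ler_pXn2r _ 2) ?nnegrE // normC2_rect ?ZtoC_real //.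
by rewrite real_normK ?ZtoC_real // lerDl -realEsqr ZtoC_real.
Qed.

Lemma in_ball_exact (u z : K) (X : ball) :
  ball_rad X = 0%Z -> z = center X * u -> in_ball u z X.
Proof. by move=> r0 ->; rewrite /in_ball r0 subrr normr0 /ZtoC mul0r. Qed.

Lemma in_ball_norm (u z : K) (X : ball) : 0 <= u -> in_ball u z X ->
  `|z| <= ZtoC (ball_size X + ball_rad X) * u.
Proof.
move=> u0 zX; rewrite -[z](subrK (center X * u)).
apply: le_trans (ler_normD _ _) _; rewrite ZtoCD [leRHS]mulrDl addrC lerD //.
by rewrite normrM (ger0_norm u0) ler_wpM2r // normr_center.
Qed.

(** The real part of the center alone serves as lower bound for its modulus, again without square
    roots. *)
Lemma in_ball_norm_ge (u z : K) (X : ball) : 0 <= u -> in_ball u z X ->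
  ZtoC (Z.abs (ball_re X) - ball_rad X) * u <= `|z|.
Proof.
move=> u0 zX; rewrite ZtoCB mulrBl lerBlDr.
apply: le_trans (_ : `|center X * u| <= _).
  by rewrite normrM (ger0_norm u0) ler_wpM2r // normr_center_re.
rewrite -[center X * u](subKr z); apply: le_trans (ler_normB _ _) _.
by rewrite lerD2l.
Qed.

Lemma in_ball_add (u z w : K) (X Y : ball) :
  in_ball u z X -> in_ball u w Y -> in_ball u (z + w) (ball_add X Y).
Proof.
move=> zX wY; rewrite /in_ball /center /= !ZtoCD [leRHS]mulrDl.
have -> : z + w - (ZtoC (ball_re X) + ZtoC (ball_re Y)
    + 'i * (ZtoC (ball_im X) + ZtoC (ball_im Y))) * u
  = (z - center X * u) + (w - center Y * u) by rewrite /center; ring.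
exact: le_trans (ler_normD _ _) (lerD zX wY).
Qed.

Lemma center_mul (X Y : ball) : center (ball_mul X Y) = center X * center Y.
Proof.
rewrite /center /= ZtoCB ZtoCD !ZtoCM.
transitivity (ZtoC (ball_re X) * ZtoC (ball_re Y)
  + 'i ^+ 2 * (ZtoC (ball_im X) * ZtoC (ball_im Y))
  + 'i * (ZtoC (ball_re X) * ZtoC (ball_im Y) + ZtoC (ball_im X) * ZtoC (ball_re Y))).
  by rewrite sqrCi mulN1r.
by ring.
Qed.

Lemma in_ball_mul (u v z w : K) (X Y : ball) : 0 <= u -> 0 <= v ->
  in_ball u z X -> in_ball v w Y -> in_ball (u * v) (z * w) (ball_mul X Y).
Proof.
move=> u0 v0 zX wY; rewrite /in_ball center_mul.
have -> : z * w - center X * center Y * (u * v) =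
  z * (w - center Y * v) + (z - center X * u) * (center Y * v) by ring.
apply: le_trans (ler_normD _ _) _; rewrite !normrM (ger0_norm v0).
rewrite /= (ZtoCD ((_ + _) * _)%Z) !(ZtoCM (_ + _)%Z) !(ZtoCM (ball_rad X)).
have -> (a b c d : K) : (a * b + c * d) * (u * v) = (a * u) * (b * v) + (c * u) * (d * v).
  by ring.
apply: lerD; apply: ler_pM; rewrite ?mulr_ge0 //.
  exact: in_ball_norm.
by rewrite ler_wpM2r // normr_center.
Qed.

Lemma in_ball_scale (s u z : K) (X : ball) : 0 <= s ->
  in_ball u z X -> in_ball (s * u) (s * z) X.
Proof.
move=> s0 zX; rewrite /in_ball !(mulrCA _ s) -mulrBr normrM (ger0_norm s0).
exact: ler_wpM2l.
Qed.

Lemma in_ball_shift (k : nat) (u z : K) (X : ball) : 0 <= u ->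
  in_ball u z X -> in_ball (2 ^+ k * u) z (ball_shift k X).
Proof.
move=> u0 zX; rewrite /in_ball /center /=.
have k0 : (0 < 2 ^ Z.of_nat k)%Z by apply: Z.pow_pos_nonneg; lia.
(* Division with remainder by $2^k$. The remainders of the two coordinates and of the radius each
   cost at most one new unit, hence the [+ 3]. *)
have split x : exists2 r, ZtoC x = ZtoC (Z.shiftr x (Z.of_nat k)) * 2 ^+ k + ZtoC r
    & (0 <= r <= 2 ^ Z.of_nat k)%Z.
  exists (x mod 2 ^ Z.of_nat k)%Z; last first.
    by have := Z.mod_pos_bound x _ k0; lia.
  rewrite Z.shiftr_div_pow2; last by lia.
  by rewrite -ZtoC_pow2 -ZtoCM -ZtoCD Z.mul_comm -Z.div_mod //; lia.
have bnd r : (0 <= r <= 2 ^ Z.of_nat k)%Z -> `|ZtoC r| <= 2 ^+ k.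
  by move=> ?; rewrite normr_ZtoC -ZtoC_pow2 ler_ZtoC //; lia.
have [r1 E1 /bnd b1] := split (ball_re X).
have [r2 E2 /bnd b2] := split (ball_im X).
have [r3 E3 /bnd b3] := split (ball_rad X).
move: zX; rewrite /in_ball /center E1 E2 E3 => zX.
set q1 := ZtoC (Z.shiftr _ _) in zX *; set q2 := ZtoC (Z.shiftr (ball_im X) _) in zX *.
rewrite ZtoCD; set q3 := ZtoC (Z.shiftr _ _) in zX *.
have -> : z - (q1 + 'i * q2) * (2 ^+ k * u) =
  (z - (q1 * 2 ^+ k + ZtoC r1 + 'i * (q2 * 2 ^+ k + ZtoC r2)) * u)
  + (ZtoC r1 + 'i * ZtoC r2) * u by ring.
apply: le_trans (ler_normD _ _) _; rewrite normrM (ger0_norm u0) mulrA.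
have -> : (q3 + ZtoC 3) * 2 ^+ k * u = (q3 * 2 ^+ k + 2 ^+ k) * u + (2 ^+ k + 2 ^+ k) * u.
  rewrite (_ : ZtoC 3 = 1 + 1 + 1); last by rewrite (ZtoC_nat 3); ring.
  by ring.
apply: lerD.
  apply: le_trans zX _; rewrite ler_wpM2r // lerD2l.
  by apply: le_trans (real_ler_norm (ZtoC_real _)) b3.
rewrite ler_wpM2r //; apply: le_trans (ler_normD _ _) _; apply: lerD => //.
by rewrite normrM normCi mul1r.
Qed.

End Ball.

(** * Spherically symmetric trees *)

(* The set is the singleton of the root, or empty for the empty tree, over which
   the cone is a single vertex. *)
Definition rooted := {G : sgraph & {set G}}.

(** The list runs from the root downwards: [me.1] is the number of children at a level, [me.2] the
    scaling exponent for [tree_pair]. *)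
Fixpoint tree (h : seq (nat * nat)) : rooted :=
  if h is me :: h' then
    let G := tree h' in existT _ (cone (tag G) (tagged G) me.1) (apex _ _ _)
  else existT _ void_graph set0.

Lemma card_tree_root h : (#|tagged (tree h)| <= 1)%N.
Proof. by case: h => [|me h] /=; rewrite ?cards0 ?cards1. Qed.

(** The extra summand reserves one edge at the root for a future parent, which carries the bound
    through the induction; a root itself has at most [m < Delta] children. *)
Lemma tree_degree (Delta : nat) h : all (fun me => me.1 < Delta)%N h ->
  forall v : tag (tree h), ((v \in tagged (tree h)) + degree v <= Delta)%N.
Proof.
elim: h => [_ []|[m e] h IH /= /andP[mD /IH{}IH]] //.
case=> [[]|[i v]].
  rewrite degree_cone_apex inE eqxx.
  apply: leq_trans mD; rewrite add1n ltnS.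
  by rewrite -[leqRHS]muln1 leq_mul2l card_tree_root orbT.
by rewrite degree_cone_inr inE /= add0n IH.
Qed.

(* Up to a common factor, the values of [avoid] at [x] on the empty set and on the
   root, when [b = x * D]; see [tree_pairE]. With [t = 1/2], the exponents [e]
   keep both coordinates of order 1. *)
Fixpoint tree_pair (K : comNzRingType) (D b t : K) (h : seq (nat * nat)) :
    K * K :=
  if h is (m, e) :: h' then
    let PQ := tree_pair K D b t h' in
    let U := D * PQ.1 ^+ m in
    (t ^+ e * (U + b * PQ.2 ^+ m), t ^+ e * U)
  else (1, 1).

(** Applied to evaluation at a point, this identifies the values of the polynomial pair with the
    recursion run on numbers. *)
Lemma rmorph_tree_pair (K L : comNzRingType) (f : {rmorphism K -> L}) D b t h :
  tree_pair L (f D) (f b) (f t) h =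
  (f (tree_pair K D b t h).1, f (tree_pair K D b t h).2).
Proof.
elim: h => [|[m e] h IH] /=; first by rewrite rmorph1.
by rewrite IH /= !(rmorphM, rmorphD, rmorphXn).
Qed.

Lemma tree_pairE (K : idomainType) (D t x : K) h : D != 0 -> t != 0 ->
  exists2 c : K, c != 0 & tree_pair K D (x * D) t h =
    (c * avoid K (tag (tree h)) set0 x,
     c * avoid K (tag (tree h)) (tagged (tree h)) x).
Proof.
move=> D0 t0; elim: h => [|[m e] h [c c0 IH]] /=.
  by exists 1; rewrite ?oner_neq0 // !avoid_void mulr1.
(* The [m] copies contribute [c ^+ m] to both entries, the level itself [t ^+ e * D]. *)
exists (t ^+ e * D * c ^+ m); first by rewrite !mulf_neq0 ?expf_neq0.
by rewrite IH /= avoid_cone avoid_apex !exprMn; congr pair; ring.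
Qed.

Fixpoint tree_deg (Delta : nat) (h : seq (nat * nat)) : nat :=
  if h is me :: h' then (Delta + me.1 * tree_deg Delta h')%N else 0%N.

Lemma size_exp_leS (K : comNzRingType) (p : {poly K}) m n :
  (size p <= n.+1)%N -> (size (p ^+ m)%R <= (m * n).+1)%N.
Proof.
move=> pn; apply: leq_trans (size_poly_exp_leq _ _) _.
by rewrite ltnS mulnC leq_mul2l -subn1 leq_subLR add1n pn orbT.
Qed.

Lemma size_mul_leS (K : comNzRingType) (p q : {poly K}) m n :
  (size p <= m.+1)%N -> (size q <= n.+1)%N -> (size (p * q)%R <= (m + n).+1)%N.
Proof.
by move=> pm qn; apply: leq_trans (size_polyMleq _ _) _; lia.
Qed.

Lemma size_tree_pair (K : comNzRingType) (D b : {poly K}) (t : K) Delta h :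
  (size D <= Delta.+1)%N -> (size b <= Delta.+1)%N ->
  let PQ := tree_pair {poly K} D b t%:P h in
  (size PQ.1 <= (tree_deg Delta h).+1)%N &&
  (size PQ.2 <= (tree_deg Delta h).+1)%N.
Proof.
move=> sD sb; elim: h => [|[m e] h /andP[s1 s2]] /=.
  by rewrite size_poly1.
have st (p : {poly K}) : (size (t%:P ^+ e * p)%R <= size p)%N.
  by rewrite -rmorphXn /= mul_polyC size_scale_leq.
have sU := size_mul_leS _ _ _ _ _ sD (size_exp_leS _ _ m _ s1).
have sV := size_mul_leS _ _ _ _ _ sb (size_exp_leS _ _ m _ s2).
rewrite !(leq_trans (st _)) //.
by apply: leq_trans (size_polyD _ _) _; rewrite geq_max sU sV.
Qed.

(** The degree bound grows like the product of the branching numbers, too large to compute in unary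
    [nat]. *)
Fixpoint tree_degZ (Delta : Z) (h : seq (nat * nat)) : Z :=
  if h is me :: h' then (Delta + Z.of_nat me.1 * tree_degZ Delta h')%Z else 0%Z.

Lemma tree_degZE Delta h :
  tree_degZ (Z.of_nat Delta) h = Z.of_nat (tree_deg Delta h).
Proof. by elim: h => //= me h ->; lia. Qed.

(** Fixed-point product: multiplying two balls in the unit $2^{-p}$ gives the unit $2^{-2p}$, and
    the shift restores $2^{-p}$. *)
Definition ball_mulp (p : nat) (X Y : ball) : ball := ball_shift p (ball_mul X Y).

Fixpoint ball_exp (p : nat) (X : ball) (m : nat) : ball :=
  if m is m'.+1 then ball_mulp p (ball_exp p X m') X
  else Ball (2 ^ Z.of_nat p)%Z 0 0.

Fixpoint ball_pair (p : nat) (D b : ball) (h : seq (nat * nat)) : ball * ball :=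
  if h is (m, e) :: h' then
    let PQ := ball_pair p D b h' in
    let U := ball_mulp p D (ball_exp p PQ.1 m) in
    (ball_shift e (ball_add U (ball_mulp p b (ball_exp p PQ.2 m))),
     ball_shift e U)
  else let one := Ball (2 ^ Z.of_nat p)%Z 0 0 in (one, one).

Section BallPair.
Variables (K : numClosedFieldType) (p : nat).
Let u : K := 2 ^- p.

Lemma ulp_gt0 : 0 < u. Proof. by rewrite invr_gt0 exprn_gt0. Qed.
Let u0 : 0 <= u := ltW ulp_gt0.

Lemma in_ball1 : in_ball K u 1 (Ball (2 ^ Z.of_nat p)%Z 0 0).
Proof.
apply: in_ball_exact => //; rewrite /center /= ZtoC_pow2 /ZtoC mulr0 addr0.
by rewrite /u mulfV // expf_neq0 // pnatr_eq0.
Qed.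

Lemma in_ball_mulp z w X Y : in_ball K u z X -> in_ball K u w Y ->
  in_ball K u (z * w) (ball_mulp p X Y).
Proof.
move=> zX wY; have := in_ball_mul _ _ _ _ _ _ _ u0 u0 zX wY.
move=> /(in_ball_shift _ p _ _ _ (mulr_ge0 u0 u0)).
by rewrite mulrA /u mulfV ?mul1r // expf_neq0 // pnatr_eq0.
Qed.

Lemma in_ball_exp z X m : in_ball K u z X -> in_ball K u (z ^+ m) (ball_exp p X m).
Proof.
move=> zX; elim: m => [|m IH]; first exact: in_ball1.
by rewrite exprSr; apply: in_ball_mulp.
Qed.

(** Scaling keeps the integers and shrinks the unit by $2^e$; the shift brings the unit back. *)
Lemma in_ball_half z X e : in_ball K u z X ->
  in_ball K u (2^-1 ^+ e * z) (ball_shift e X).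
Proof.
have h0 : 0 <= 2^-1 ^+ e :> K by rewrite exprn_ge0 // invr_ge0.
move=> /(in_ball_scale _ _ _ _ _ h0) /(in_ball_shift _ e _ _ _ (mulr_ge0 h0 u0)).
by rewrite mulrA -exprMn mulfV ?expr1n ?mul1r // pnatr_eq0.
Qed.

Lemma in_ball_pair D b X Y h : in_ball K u D X -> in_ball K u b Y ->
  let PQ := tree_pair K D b 2^-1 h in let B := ball_pair p X Y h in
  in_ball K u PQ.1 B.1 /\ in_ball K u PQ.2 B.2.
Proof.
move=> DX bY; elim: h => [|[m e] h [IH1 IH2]] /=; first by split; apply: in_ball1.
have U := in_ball_mulp _ _ _ _ DX (in_ball_exp _ _ m IH1).
have V := in_ball_mulp _ _ _ _ bY (in_ball_exp _ _ m IH2).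
by split; apply: in_ball_half => //; apply: in_ball_add.
Qed.

End BallPair.

(** * Certificates *)

(** The two balls passed on enclose the denominator $(z+\Delta-1)^\Delta$ and the numerator
    $-z(\Delta-1)^{\Delta-1}$ of $\lambda$ at $z = (x+iy)/2^p$; the second is exact. *)
Definition eval_ball (Delta : nat) (h : seq (nat * nat)) (p : nat) (x y : Z) : ball :=
  let c := Z.pred (Z.of_nat Delta) in
  (ball_pair p (ball_exp p (Ball (x + c * 2 ^ Z.of_nat p)%Z y 0) Delta)
    (let f := (- c ^ Z.of_nat Delta.-1)%Z in Ball (x * f)%Z (y * f)%Z 0) h).1.

(* The approximate root is [(x + 'i y) / 2 ^ p], of modulus at most [511 / 512],
   and the test of [root_near] with [r = 1 / 512] moves it by [j / 2 ^ p]. *)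
Definition certificate (Delta : nat) (h : seq (nat * nat)) (p : nat)
    (x y j : Z) : bool :=
  let X := eval_ball Delta h p x y in
  let Y := eval_ball Delta h p (x + j) y in
  [&& all (fun me => me.1 < Delta)%N h,
      (0 <=? j)%Z,
      ((512 * x) ^ 2 + (512 * y) ^ 2 <=? (511 * 2 ^ Z.of_nat p) ^ 2)%Z,
      (2 * tree_degZ (Z.of_nat Delta) h * j * 512 <=? 2 ^ Z.of_nat p)%Z
    & (2 * (ball_size X + ball_rad X) <? Z.abs (ball_re Y) - ball_rad Y)%Z].

Section Certificate.
Variables (K : numClosedFieldType) (Delta : nat) (h : seq (nat * nat)) (p : nat).
Hypothesis Delta_gt1 : (1 < Delta)%N.
Let u : K := 2 ^- p.
Let c : K := Delta%:R - 1.
(** Denominator and numerator of $\lambda$ as polynomials in $\alpha$; the recursion run on them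
    yields [P]. *)
Let DP : {poly K} := ('X + c%:P) ^+ Delta.
Let bP : {poly K} := - 'X * (c ^+ Delta.-1)%:P.
Let P : {poly K} := (tree_pair {poly K} DP bP (2^-1)%:P h).1.

Lemma horner_tree_pair z : P.[z] =
  (tree_pair K ((z + c) ^+ Delta) (- z * c ^+ Delta.-1) 2^-1 h).1.
Proof.
have := rmorph_tree_pair _ _ (horner_eval z) DP bP (2^-1)%:P h.
rewrite /= !horner_evalE hornerC.
have -> : DP.[z] = (z + c) ^+ Delta by rewrite horner_exp hornerD hornerX hornerC.
have -> : bP.[z] = - z * c ^+ Delta.-1 by rewrite hornerM hornerN hornerX hornerC.
by move=> ->.
Qed.

Lemma size_tree_poly : (size P <= (tree_deg Delta h).+1)%N.
Proof.
have sX : (size (('X + c%:P) ^+ Delta)%R <= Delta.+1)%N.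
  by rewrite -[X in (_ <= X.+1)%N]muln1 size_exp_leS // size_XaddC.
have sb : (size bP <= Delta.+1)%N.
  rewrite /bP mulrC mul_polyC (leq_trans (size_scale_leq _ _)) //.
  by rewrite size_polyN size_polyX ltnS ltnW.
by have /andP[] := size_tree_pair K DP bP 2^-1 Delta h sX sb.
Qed.

Lemma in_ball_eval x y : let z := center K (Ball x y 0) * u in
  in_ball K u P.[z] (eval_ball Delta h p x y).
Proof.
move=> z; rewrite horner_tree_pair.
have zc : ZtoC K (Z.pred (Z.of_nat Delta)) = c.
  by rewrite -Z.sub_1_r ZtoCB ZtoC_nat.
have zcX : ZtoC K (- Z.pred (Z.of_nat Delta) ^ Z.of_nat Delta.-1) = - c ^+ Delta.-1.
  rewrite ZtoCN; congr (- _); elim: Delta.-1 => [|k IH]; first exact: (ZtoC_nat K 1).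
  rewrite (_ : Z.of_nat k.+1 = Z.succ (Z.of_nat k)); last by lia.
  by rewrite Z.pow_succ_r ?ZtoCM ?IH ?zc ?exprS //; lia.
apply: (proj1 (in_ball_pair _ _ _ _ _ _ _ _ _)).
  apply: in_ball_exp; apply: in_ball_exact => //.
  rewrite /z /center /= ZtoCD ZtoCM zc ZtoC_pow2.
  have uK : 2 ^+ p * u = 1 by rewrite /u mulfV // expf_neq0 // pnatr_eq0.
  by rewrite [in RHS]addrAC [RHS]mulrDl -[c * _ * u]mulrA uK mulr1.
apply: in_ball_exact => //.
have E (a b f v : K) : - ((a + 'i * b) * v) * f = (a * - f + 'i * (b * - f)) * v.
  by ring.
by rewrite /z /center /= !ZtoCM zcX E.
Qed.

Lemma certificate_root x y j : certificate Delta h p x y j ->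
  exists2 z : K, root P z & `|z| < 1.
Proof.
case/and5P => _ /Z.leb_le j0 /Z.leb_le small /Z.leb_le close /Z.ltb_lt big.
have up : u * 2 ^+ p = 1 by rewrite /u mulVf // expf_neq0 // pnatr_eq0.
have u0 : 0 < u := ulp_gt0 K p.
pose a := center K (Ball x y 0) * u.
pose b := center K (Ball (x + j) y 0) * u.
have ba : `|b - a| = ZtoC K j * u.
  rewrite -mulrBl normrM (gtr0_norm u0) /center /= ZtoCD.
  have -> : ZtoC K x + ZtoC K j + 'i * ZtoC K y - (ZtoC K x + 'i * ZtoC K y) = ZtoC K j.
    by ring.
  by rewrite normr_ZtoC Z.abs_eq.
have r0 : 0 < 512^-1 :> K by rewrite invr_gt0.
have [||z zP za] := root_near K P _ a b 512^-1 size_tree_poly r0.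
- rewrite ba -[512^-1]mul1r ler_pdivlMr //.
  rewrite -[leRHS]up; apply: le_trans (_ : ZtoC K (2 ^ Z.of_nat p) * u <= _);
    last by rewrite ZtoC_pow2 mulrC.
  apply: le_trans (_ : ZtoC K (2 * tree_degZ (Z.of_nat Delta) h * j * 512) * u <= _).
    rewrite tree_degZE !ZtoCM ZtoC_nat (ZtoC_nat K 2) (ZtoC_nat K 512).
    by rewrite le_eqVlt; apply/orP; left; apply/eqP; ring.
  by rewrite ler_wpM2r ?ler_ZtoC // ltW.
- have A := in_ball_norm _ _ _ _ (ltW u0) (in_ball_eval x y).
  have B := in_ball_norm_ge _ _ _ _ (ltW u0) (in_ball_eval (x + j) y).
  apply: lt_le_trans B; apply: le_lt_trans (_ : 2 * (ZtoC K _ * u) < _).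
    by rewrite ler_pM2l //; exact: A.
  by rewrite mulrA ltr_pM2r // -(ZtoC_nat K 2) -ZtoCM ltr_ZtoC.
exists z => //.
have a1 : `|a| <= 511 / 512.
  rewrite -(@ler_pXn2r _ 2) ?nnegrE ?divr_ge0 // normrM (gtr0_norm u0) exprMn.
  rewrite normC2_rect ?ZtoC_real //=.
  have := ler_ZtoC K _ _ small; rewrite !Z.pow_2_r ZtoCD !ZtoCM ZtoC_pow2.
  rewrite (ZtoC_nat K 511) (ZtoC_nat K 512) => le.
  have w0 : 0 <= (u / 512) ^+ 2 by rewrite exprn_ge0 // divr_ge0 // ltW.
  have n0 : 512 != 0 :> K by rewrite pnatr_eq0.
  have E (s t v : K) : (s ^+ 2 + t ^+ 2) * v ^+ 2 =
    (512 * s * (512 * s) + 512 * t * (512 * t)) * (v / 512) ^+ 2 by field.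
  have F (q v : K) :
    511 * q * (511 * q) * (v / 512) ^+ 2 = (511 / 512 * (v * q)) ^+ 2 by field.
  by rewrite E; have := ler_wpM2r w0 le; rewrite F up mulr1.
(* Strictness comes from $|z-a| < 1/512$, and $1/512 + 511/512 = 1$. *)
rewrite -[z](subrK a); apply: le_lt_trans (ler_normD _ _) _.
apply: lt_le_trans (ltr_leD za a1) _.
by rewrite (_ : _ + _ = 1 :> K) ?lexx //; field.
Qed.

Lemma certificate_zero x y j : certificate Delta h p x y j ->
  exists2 z : K, `|z| < 1 &
    avoid K (tag (tree h)) set0 (- z * c ^+ Delta.-1 / (c + z) ^+ Delta) = 0.
Proof.
move=> /certificate_root [z /rootP Pz z1]; exists z => //.
(* A zero of $c+z$ would have modulus $c = \Delta-1 \ge 1$. *)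
have cz : (c + z) ^+ Delta != 0.
  rewrite expf_neq0 //; apply: contraTneq z1 => /eqP; rewrite addrC addr_eq0.
  have cE : c = Delta.-1%:R by rewrite -subn1 natrB // ltnW.
  by move=> /eqP ->; rewrite normrN cE normr_nat ltrn1 -leqNgt -ltnS prednK // ltnW.
have h0 : 2^-1 != 0 :> K by rewrite invr_eq0 pnatr_eq0.
move: Pz; rewrite horner_tree_pair addrC.
(* Here [x * D] is the numerator of $\lambda$, so $P(z)$ is $Z(\lambda)$ times the nonzero factor
   [k]. *)
have [k k0] := tree_pairE K _ _ (- z * c ^+ Delta.-1 / (c + z) ^+ Delta) h cz h0.
rewrite divfK // => -> /= /eqP.
by rewrite mulf_eq0 (negPf k0) => /eqP.
Qed.

End Certificate.

Lemma zero_of_certificate (R : realType) (Delta : nat) h p x y j :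
  (1 < Delta)%N -> certificate Delta h p x y j ->
  exists (lambda : R[i]) (G : sgraph),
    [/\ @U R Delta lambda, max_degree_at_most Delta G
      & (indep_poly R[i] G).[lambda] = 0].
Proof.
move=> D1 cert; have [z z1 zero] := certificate_zero R[i] Delta h p D1 x y j cert.
exists (- z * (Delta%:R - 1) ^+ Delta.-1 / (Delta%:R - 1 + z) ^+ Delta).
exists (tag (tree h)); split; first by exists z.
  apply/bigmax_leqP => v _; have /and5P[hD _ _ _ _] := cert.
  exact: leq_trans (leq_addl _ _) (tree_degree _ _ hD v).
by rewrite indep_polyE.
Qed.

(** * Numerical certificates for $\Delta = 3, \dots, 9$ and the conclusion *)

(** The list ends with the leaves, which have 0 children. After it come the precision [p], the
    coordinates of the approximate root and the step, all three in units of $2^{-p}$. The trailing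
    power of 2 in the coordinates provides guard bits that absorb the rounding errors. The data for
    the other $\Delta$ have the same layout. *)
Lemma certificate3 :
  certificate 3
    [:: (2, 0); (2, 1); (2, 2); (2, 1); (1, 2); (2, 0); (2, 2); (2, 2);
        (1, 1); (2, 2); (2, 0); (2, 3); (2, 1); (2, 5); (0, 0)]%N
    52 (-128085295 * 2 ^ 25) (36562164 * 2 ^ 25) (2 ^ 27).
Proof. by vm_compute. Qed.

Lemma certificate4 :
  certificate 4
    [:: (3, 4); (2, 6); (3, 5); (3, 2); (2, 7); (3, 4); (3, 5); (1, 6);
        (3, 5); (3, 4); (2, 5); (3, 7); (3, 3); (3, 7); (3, 6); (3, 5);
        (0, 6)]%N
    75 (-47165376395 * 2 ^ 38) (128374647000 * 2 ^ 38) (2 ^ 40).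
Proof. by vm_compute. Qed.

Lemma certificate5 :
  certificate 5
    [:: (4, 7); (4, 8); (4, 8); (4, 7); (2, 9); (4, 10); (4, 7); (2, 11);
        (4, 8); (4, 7); (2, 10); (4, 9); (4, 8); (4, 8); (4, 10); (4, 7);
        (0, 10)]%N
    95 (-6048075095008 * 2 ^ 51) (16455479270571 * 2 ^ 51) (2 ^ 53).
Proof. by vm_compute. Qed.

Lemma certificate6 :
  certificate 6
    [:: (5, 11); (5, 9); (4, 11); (5, 10); (3, 11); (5, 13); (4, 11);
        (5, 14); (3, 11); (5, 14); (5, 14); (5, 14); (5, 13); (5, 16);
        (0, 12)]%N
    95 (-67466116994027 * 2 ^ 49) (18997265146765 * 2 ^ 49) (2 ^ 51).
Proof. by vm_compute. Qed.

Lemma certificate7 :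
  certificate 7
    [:: (6, 13); (6, 20); (4, 17); (6, 12); (4, 16); (6, 18); (5, 13);
        (6, 16); (4, 14); (6, 16); (5, 16); (6, 17); (5, 15); (6, 15);
        (2, 17); (6, 16); (0, 17)]%N
    112 (-8628645981097818 * 2 ^ 59) (2434676205483866 * 2 ^ 59) (2 ^ 61).
Proof. by vm_compute. Qed.

Lemma certificate8 :
  certificate 8
    [:: (6, 17); (7, 19); (5, 21); (7, 21); (5, 20); (7, 21); (5, 21);
        (7, 18); (5, 17); (7, 23); (5, 21); (7, 26); (7, 18); (7, 21);
        (3, 20); (7, 23); (0, 21)]%N
    119 (-137971908944583244 * 2 ^ 62) (38978268834777248 * 2 ^ 62) (2 ^ 64).
Proof. by vm_compute. Qed.

Lemma certificate9 :
  certificate 9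
    [:: (6, 19); (8, 22); (6, 27); (8, 23); (6, 23); (8, 24); (5, 27);
        (8, 20); (7, 21); (8, 28); (5, 26); (8, 25); (7, 23); (8, 22);
        (5, 24); (8, 24); (0, 26)]%N
    134 (-1104630712310301477 * 2 ^ 74) (312019976723972984 * 2 ^ 74) (2 ^ 76).
Proof. by vm_compute. Qed.

Theorem theorem3 (R : realType) (Delta : nat)
    (hDelta : Delta \in [:: 3; 4; 5; 6; 7; 8; 9]%N) :
  exists (lambda : R[i]) (G : sgraph),
    [/\ @U R Delta lambda, max_degree_at_most Delta G
      & (indep_poly R[i] G).[lambda] = 0].
Proof.
move: hDelta; rewrite !inE.
case/orP => [/eqP ->|].
  exact: zero_of_certificate R 3 _ _ _ _ _ isT certificate3.
case/orP => [/eqP ->|].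
  exact: zero_of_certificate R 4 _ _ _ _ _ isT certificate4.
case/orP => [/eqP ->|].
  exact: zero_of_certificate R 5 _ _ _ _ _ isT certificate5.
case/orP => [/eqP ->|].
  exact: zero_of_certificate R 6 _ _ _ _ _ isT certificate6.
case/orP => [/eqP ->|].
  exact: zero_of_certificate R 7 _ _ _ _ _ isT certificate7.
case/orP => [/eqP ->|].
  exact: zero_of_certificate R 8 _ _ _ _ _ isT certificate8.
move=> /eqP ->.
exact: zero_of_certificate R 9 _ _ _ _ _ isT certificate9.
Qed.
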